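(* Let $I$ be a non-empty set and let $E\subseteq\mathbb{R}^I$ be a linear subspace containing all $e_i$ ($i\in I$), endowed with a complete absolute normalised norm $\|\cdot\|_E$ such that $\operatorname{span}\{e_i:i\in I\}$ is dense in $E$. If $(X_i)_{i\in I}$ is a family of msluacs (resp. mluacs) Banach spaces and if $E$ is MLUR, then $\bigl[\bigoplus_{i\in I}X_i\bigr]_E$ is also msluacs (resp. mluacs).
   Context: Banach spaces are real; $S_X$ denotes the unit sphere of $X$ and $X^*$ its dual. A Banach space $X$ is called - MLUR (midpoint locally uniformly rotund) if for all sequences $(x_n)$, $(y_n)$ in $S_X$ and every $x\in S_X$: $\|x-\tfrac{x_n+y_n}{2}\|\to 0$ implies $\|x_n-y_n\|\to 0$; - mluacs if for all sequences $(x_n)$, $(y_n)$ in $S_X$, every $x\in S_X$ and every $x^*\in S_{X^*}$: $\|x-\tfrac{x_n+y_n}{2}\|\to 0$ and $x^*(x_n)\to 1$ imply $x^*(y_n)\to 1$; - msluacs if for all sequences $(x_n)$, $(y_n)$ in $S_X$, every $x\in S_X$ and every sequence $(x_n^* )$ in $S_{X^*}$: $\|x-\tfrac{x_n+y_n}{2}\|\to 0$ and $x_n^*(x_n)\to 1$ imply $x_n^*(y_n)\to 1$. For a non-empty set $I$, $e_i\in\mathbb{R}^I$ denotes the characteristic function of $\{i\}$. A norm $\|\cdot\|_E$ on a subspace $E$ of $\mathbb{R}^I$ (with all $e_i\in E$) is absolute if whenever $(a_i)_{i\in I}\in E$, $(b_i)_{i\in I}\in\mathbb{R}^I$ and $|a_i|=|b_i|$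 for all $i\in I$, then $(b_i)_{i\in I}\in E$ and $\|(a_i)_{i\in I}\|_E=\|(b_i)_{i\in I}\|_E$; it is normalised if $\|e_i\|_E=1$ for every $i\in I$. For a family $(X_i)_{i\in I}$ of Banach spaces, the absolute sum with respect to $E$ is $\bigl[\bigoplus_{i\in I}X_i\bigr]_E=\{(x_i)_{i\in I}\in\prod_{i\in I}X_i:(\|x_i\|)_{i\in I}\in E\}$ with the norm $\|(x_i)_{i\in I}\|_E=\|(\|x_i\|)_{i\in I}\|_E$; it is a Banach space. *)

(* Defs.v *)
From HB Require Import structures.
From mathcomp Require Import all_boot all_order all_algebra.
From mathcomp Require Import all_classical all_reals all_analysis.
From mathcomp Require Import lra ring.

Set Implicit Arguments.
Unset Strict Implicit.
Unset Printing Implicit Defensive.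

Import Order.TTheory GRing.Theory Num.Theory.
Import numFieldNormedType.Exports.

Local Open Scope classical_set_scope.
Local Open Scope ring_scope.

Section Rotundity.
Context {R : realType}.
Implicit Types X : completeNormedModType R.

Definition sphere X : set X := [set x | `|x| = 1].
Arguments sphere : clear implicits.

Definition dual_norm X (f : {linear X -> R^o}) : R :=
  sup [set `|f x| | x in [set x : X | `|x| <= 1]].

(* Continuity is required separately because [sup] is 0 on unbounded sets. *)
Definition dual_sphere X : set {linear X -> R^o} :=
  [set f : {linear X -> R^o} | continuous f /\ dual_norm f = 1].
Arguments dual_sphere : clear implicits.

Definition midpoint_cvg X (x_ y_ : X^nat) (x : X) : Prop :=
  `|x - 2^-1 *: (x_ n + y_ n)| @[n --> \oo] --> (0 : R).

Definition MLUR X : Prop :=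
  forall (x_ y_ : X^nat) (x : X),
    (forall n, sphere X (x_ n)) -> (forall n, sphere X (y_ n)) ->
    sphere X x -> midpoint_cvg x_ y_ x ->
    `|x_ n - y_ n| @[n --> \oo] --> (0 : R).

Definition mluacs X : Prop :=
  forall (x_ y_ : X^nat) (x : X) (f : {linear X -> R^o}),
    (forall n, sphere X (x_ n)) -> (forall n, sphere X (y_ n)) ->
    sphere X x -> dual_sphere X f -> midpoint_cvg x_ y_ x ->
    f (x_ n) @[n --> \oo] --> (1 : R) ->
    f (y_ n) @[n --> \oo] --> (1 : R).

Definition msluacs X : Prop :=
  forall (x_ y_ : X^nat) (x : X) (f_ : nat -> {linear X -> R^o}),
    (forall n, sphere X (x_ n)) -> (forall n, sphere X (y_ n)) ->
    sphere X x -> (forall n, dual_sphere X (f_ n)) -> midpoint_cvg x_ y_ x ->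
    f_ n (x_ n) @[n --> \oo] --> (1 : R) ->
    f_ n (y_ n) @[n --> \oo] --> (1 : R).

End Rotundity.

Definition lin_span (R : realType) (V : lmodType R) (A : set V) : set V :=
  [set v | exists (n : nat) (c : 'I_n -> R) (u : 'I_n -> V),
    (forall k, A (u k)) /\ v = \sum_(k < n) c k *: u k].

(* A linear subspace of [V] with a norm of its own; only the values of         *)
(* [ns_norm] on the subspace matter.                                           *)
Record normedSubspace (R : realType) (V : lmodType R) := NormedSubspace {
  ns_pred : {pred V};
  ns_norm : V -> R;
  ns_submod : submod_closed ns_pred;
  ns_normD : {in ns_pred &, forall x y, ns_norm (x + y) <= ns_norm x + ns_norm y};
  ns_normZ : forall a : R, {in ns_pred, forall x, ns_norm (a *: x) = `|a| * ns_norm x};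
  ns_norm_eq0 : {in ns_pred, forall x, ns_norm x = 0 -> x = 0}
}.

Record ns_type (R : realType) (V : lmodType R) (S : normedSubspace V) := NsType {
  ns_val :> V;
  ns_valP : ns_val \in ns_pred S
}.

Section NormedSubspaceType.
Context {R : realType} {V : lmodType R} (S : normedSubspace V).

HB.instance Definition _ := [isSub for @ns_val R V S].
HB.instance Definition _ := [Choice of ns_type S by <:].
HB.instance Definition _ :=
  GRing.isSubmodClosed.Build R V (ns_pred S) (ns_submod S).
HB.instance Definition _ := [SubChoice_isSubLmodule of ns_type S by <:].

Let nm (x : ns_type S) : R := ns_norm S (ns_val x).

Let nmD x y : nm (x + y) <= nm x + nm y.
Proof. exact: (ns_normD (ns_valP x) (ns_valP y)). Qed.

Let nmZ (a : R) x : nm (a *: x) = `|a| * nm x.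
Proof. exact: (ns_normZ a (ns_valP x)). Qed.

Let nm_eq0 x : nm x = 0 -> x = 0.
Proof. by move=> /(ns_norm_eq0 (ns_valP x)) x0; exact: val_inj. Qed.

HB.instance Definition _ := Lmodule_isNormed.Build R (ns_type S) nmD nmZ nm_eq0.

Lemma ns_normE (x : ns_type S) : `|x| = ns_norm S (ns_val x).
Proof. by []. Qed.

End NormedSubspaceType.

Record banachSubspace (R : realType) (V : lmodType R) := BanachSubspace {
  bs_base :> normedSubspace V;
  bs_complete : forall F : set_system (ns_type bs_base),
    ProperFilter F -> cauchy F -> cvg F
}.

Definition bs_type (R : realType) (V : lmodType R) (B : banachSubspace V) : Type :=
  ns_type B.

HB.instance Definition _ (R : realType) (V : lmodType R) (B : banachSubspace V) :=
  NormedModule.copy (bs_type B) (ns_type B).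
HB.instance Definition _ (R : realType) (V : lmodType R) (B : banachSubspace V) :=
  Uniform_isComplete.Build (bs_type B) (@bs_complete R V B).

Coercion bs_banach (R : realType) (V : lmodType R) (B : banachSubspace V) :
  completeNormedModType R := bs_type B.

(* The unit vector [e_i] is the indicator function [\1_[set i] : I -> R].      *)
Record absNormedSpace (R : realType) (I : Type) := AbsNormedSpace {
  as_base :> banachSubspace (I -> R);
  as_unit_subproof : forall i, (\1_[set i] : I -> R) \in ns_pred as_base;
  as_absolute : forall a b : I -> R, a \in ns_pred as_base ->
    (forall i, `|a i| = `|b i|) ->
    b \in ns_pred as_base /\ ns_norm as_base a = ns_norm as_base b;
  as_normalised : forall i, ns_norm as_base \1_[set i] = 1
}.

Definition as_unit (R : realType) (I : Type) (E : absNormedSpace R I) (i : I) : E :=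
  NsType (as_unit_subproof E i).

Section Completeness.
Context {R : realType}.

Lemma complete_of_series (V : normedModType R) :
  (forall u : V^nat, (forall n, `|u n| <= 2^-1 ^+ n) -> cvgn (series u)) ->
  forall F : set_system V, ProperFilter F -> cauchy F -> cvg F.
Proof.
move=> hser F FF /cauchyP Fc.
have h n : exists p : V, F (ball p (2^-1 ^+ n / 2)).
  by apply: Fc; rewrite divr_gt0 // exprn_gt0 // invr_gt0.
have [p hp] := choice h.
have hu n : `|p n.+1 - p n| <= 2^-1 ^+ n.
  have [z [z1 z2]] := filter_ex (filterI (hp n) (hp n.+1)).
  move: z1 z2; rewrite -!ball_normE /ball_ /= => z1 z2.
  have := ler_normD (p n.+1 - z) (z - p n).
  rewrite addrA subrK (distrC z) exprS in z1 z2 * => hh.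
  have : 0 <= (2^-1 : R) ^+ n by rewrite exprn_ge0 // invr_ge0.
  lra.
have : cvgn (series (fun n => p n.+1 - p n)) by exact: hser.
have -> : series (fun n => p n.+1 - p n) = (fun n => p n - p 0%N).
  by apply/funext => n; rewrite /series /= telescope_sumr.
move=> hc.
have [l pl] : exists l : V, p n @[n --> \oo] --> l.
  exists (lim ((fun n => p n - p 0%N) @ \oo) + p 0%N).
  have h1 : (fun n => p n - p 0%N) @ \oo --> lim ((fun n => p n - p 0%N) @ \oo).
    exact: hc.
  apply: cvg_trans (cvgD h1 (cvg_cst (p 0%N))); apply: near_eq_cvg.
  by apply: nearW => n /=; rewrite subrK.
apply/cvg_ex; exists l; apply/cvgrPdist_lt => e e0.
have h0 : (2^-1 : R) ^+ n @[n --> \oo] --> (0 : R).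
  by apply: cvg_expr; rewrite ger0_norm ?invr_ge0 // invf_lt1 // ltr1n.
have e2 : 0 < e / 2 by rewrite divr_gt0.
have [N _ hN] : \forall n \near \oo, `|l - p n| < e / 2 /\ `|0 - 2^-1 ^+ n : R| < e / 2.
  apply: filterI; first by move/cvgrPdist_lt: pl => /(_ _ e2).
  by move/cvgrPdist_lt: h0 => /(_ _ e2).
have [a b] := hN N (leqnn N).
apply: filterS (hp N) => z; rewrite -ball_normE /ball_ /= => hz.
have := ler_normD (l - p N) (p N - z); rewrite addrA subrK.
have q0 : 0 <= (2^-1 : R) ^+ N by rewrite exprn_ge0 // invr_ge0.
move: b; rewrite sub0r normrN ger0_norm //.
lra.
Qed.

Lemma series_cvg_geom (V : completeNormedModType R) (u : V^nat) (C : R) :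
  (forall n, `|u n| <= C * 2^-1 ^+ n) -> cvgn (series u).
Proof.
move=> hu; apply: normed_cvg.
apply: (@series_le_cvg _ _ (geometric C 2^-1)).
- by move=> n; exact: normr_ge0.
- by move=> n; apply: le_trans (hu n).
- exact: hu.
- by apply: is_cvg_geometric_series; rewrite ger0_norm ?invr_ge0 // invf_lt1 // ltr1n.
Qed.

End Completeness.

Section Monotone.
Context {R : realType} {I : Type} (E : absNormedSpace R I).

Lemma as_coord_le (a : I -> R) (i : I) : a \in ns_pred E -> `|a i| <= ns_norm E a.
Proof.
move=> aE.
pose b (j : I) : R := if `[< j = i >] then a j else - a j.
have hb j : `|a j| = `|b j| by rewrite /b; case: ifP => _ //; rewrite normrN.
have [bE ab] := as_absolute aE hb.
have sE : a + b \in ns_pred E by rewrite rpredD.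
have h : 2^-1 *: (a + b) = a i *: (\1_[set i] : I -> R).
  apply/funext => j; rewrite -[LHS]/(2^-1 * (a j + b j)).
  rewrite -[RHS]/(a i * \1_[set i] j) indicE /b; case: asboolP => ji.
    by rewrite ji mem_set // mulr1; field.
  by rewrite memNset // subrr !mulr0.
have := ns_normZ (a i) (as_unit_subproof E i).
rewrite -h (as_normalised E) mulr1 (ns_normZ _ sE) => <-.
have := ns_normD aE bE; rewrite -ab.
by rewrite ger0_norm ?invr_ge0 //; lra.
Qed.

Lemma as_norm_ge0 (a : I -> R) : a \in ns_pred E -> 0 <= ns_norm E a.
Proof. by move=> aE; exact: (normr_ge0 (NsType aE)). Qed.

Lemma val_sum (V : lmodType R) (B : banachSubspace V) (u : (bs_type B)^nat) n :
  ns_val (series u n) = \sum_(0 <= k < n) ns_val (u k).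
Proof.
rewrite /series /=; elim: n => [|n ih]; first by rewrite !big_nil.
by rewrite !big_nat_recr //= -ih.
Qed.

(* Any [t] in [-1, 1] is a sum of [2^-k.+1 * s_k] with signs [s_k]; [sgn_rem t n] is *)
(* [2 ^ n] times the remainder after [n] terms. It writes [a] with |a_i| <= |b_i| as   *)
(* a norm-convergent series of scaled sign changes of [b].                              *)
Fixpoint sgn_rem (t : R) (n : nat) : R :=
  if n is k.+1 then
    let r := sgn_rem t k in 2 * r - (if 0 <= r then 1 else -1)
  else t.

Let sg (t : R) n : R := if 0 <= sgn_rem t n then 1 else -1.

Let sgn_rem_le1 t n : `|t| <= 1 -> `|sgn_rem t n| <= 1.
Proof.
move=> t1; elim: n => [//|n]; rewrite /=.
case: ifPn => [r0|]; last rewrite -ltNge => r0; rewrite !ler_norml; lra.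
Qed.

Let sgn_sum t n :
  t = \sum_(0 <= k < n) 2^-1 ^+ k.+1 * sg t k + 2^-1 ^+ n * sgn_rem t n.
Proof.
elim: n => [|n ih]; first by rewrite big_nil add0r expr0 mul1r.
rewrite big_nat_recr //= {1}ih -/(sg t n) exprS; lra.
Qed.

Lemma as_monotone (a b : I -> R) : b \in ns_pred E ->
  (forall i, `|a i| <= `|b i|) -> a \in ns_pred E /\ ns_norm E a <= ns_norm E b.
Proof.
move=> bE hab.
pose t i := a i / b i.
have t1 i : `|t i| <= 1.
  rewrite /t normrM normfV; have [->|b0] := eqVneq (b i) 0.
    by rewrite normr0 invr0 mulr0.
  by rewrite ler_pdivrMr ?mul1r // normr_gt0.
have ta i : a i = t i * b i.
  rewrite /t; have [b0|b0] := eqVneq (b i) 0; last by rewrite divfK.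
  by have := hab i; rewrite b0 normr0 mulr0 normr_le0 => /eqP.
pose v n i : R := sg (t i) n * b i.
have hv n i : `|b i| = `|v n i|.
  by rewrite /v /sg normrM; case: ifP => _; rewrite ?normrN normr1 mul1r.
have vE n : v n \in ns_pred E := proj1 (as_absolute bE (hv n)).
have vN n : ns_norm E (v n) = ns_norm E b := esym (proj2 (as_absolute bE (hv n))).
pose u : (bs_type E)^nat := fun n => 2^-1 ^+ n.+1 *: (NsType (vE n) : bs_type E).
have uN n : `|u n| = 2^-1 ^+ n.+1 * ns_norm E b.
  rewrite /u normrZ ger0_norm ?exprn_ge0 ?invr_ge0 //; congr (_ * _); exact: vN.
have cu : cvgn (series u).
  apply: (@series_cvg_geom _ _ _ (ns_norm E b)) => n.
  rewrite uN exprS mulrC.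
  have := as_norm_ge0 bE.
  have : 0 <= (2^-1 : R) ^+ n by rewrite exprn_ge0 // invr_ge0.
  move=> p q; rewrite ler_wpM2l //; lra.
have sN n : `|series u n| <= (1 - 2^-1 ^+ n) * ns_norm E b.
  elim: n => [|n ih]; first by rewrite /series /= big_nil normr0 expr0 subrr mul0r.
  rewrite /series /= big_nat_recr //=.
  apply: le_trans (ler_normD _ _) _.
  rewrite uN; apply: le_trans (lerD ih (lexx _)) _.
  by rewrite -mulrDl ler_wpM2r ?as_norm_ge0 // exprS; lra.
set l := limn (series u) in cu *.
have la : ns_val l = a.
  apply/funext => i.
  have si n : ns_val (series u n) i = a i - 2^-1 ^+ n * sgn_rem (t i) n * b i.
    rewrite val_sum fct_sumE ta {1}(sgn_sum (t i) n) mulrDl addrK mulr_suml.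
    by apply: eq_bigr => k _; exact: mulrA.
  apply/eqP; rewrite eq_sym -subr_eq0 -normr_le0; apply/ler_addgt0Pl => e e0.
  rewrite addr0.
  have e2 : 0 < e / 2 by rewrite divr_gt0.
  have h0 : (2^-1 : R) ^+ n * `|b i| @[n --> \oo] --> (0 : R).
    rewrite -[X in _ --> X](mul0r `|b i|); apply: cvgM; last exact: cvg_cst.
    by apply: cvg_expr; rewrite ger0_norm ?invr_ge0 // invf_lt1 // ltr1n.
  have [N _ hN] : \forall n \near \oo,
      `|l - series u n| < e / 2 /\ `|0 - 2^-1 ^+ n * `|b i| : R| < e / 2.
    apply: filterI; first by move/cvgrPdist_lt: cu => /(_ _ e2).
    by move/cvgrPdist_lt: h0 => /(_ _ e2).
  have [p q] := hN N (leqnn N).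
  have := as_coord_le i (ns_valP (l - series u N)).
  rewrite -ns_normE /= => hc.
  have {}hc : `|ns_val l i - ns_val (series u N) i| < e / 2 by apply: le_lt_trans hc p.
  rewrite si in hc.
  have q0 : 0 <= (2^-1 : R) ^+ N by rewrite exprn_ge0 // invr_ge0.
  have : `|2^-1 ^+ N * sgn_rem (t i) N * b i| <= 2^-1 ^+ N * `|b i|.
    rewrite !normrM ler_wpM2r // ger0_norm // ler_piMr //; exact: sgn_rem_le1.
  move: q; rewrite sub0r normrN ger0_norm ?mulr_ge0 // => q h2.
  move: hc h2; rewrite ltr_norml !ler_norml => /andP[A B] /andP[C D].
  apply/andP; split; lra.
have aE : a \in ns_pred E by rewrite -la; exact: ns_valP.
split=> //; rewrite -{1}la -[leLHS]/(`|l|).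
apply/ler_addgt0Pl => e e0.
have [N _ hN] : \forall n \near \oo, `|l - series u n| < e.
  by move/cvgrPdist_lt: cu => /(_ _ e0).
have := hN N (leqnn N) => h1.
have h2 := sN N.
have := ler_normD (l - series u N) (series u N); rewrite subrK => h3.
have q0 : 0 <= (2^-1 : R) ^+ N by rewrite exprn_ge0 // invr_ge0.
have := mulr_ge0 q0 (as_norm_ge0 bE).
lra.
Qed.

End Monotone.

Definition dprod (R : realType) (I : Type) (X : I -> completeNormedModType R) : Type :=
  forall i, X i.

Section DependentProduct.
Context {R : realType} {I : Type} (X : I -> completeNormedModType R).

HB.instance Definition _ := gen_eqMixin (dprod X).
HB.instance Definition _ := gen_choiceMixin (dprod X).

Let dp_add (x y : dprod X) : dprod X := fun i => x i + y i.
Let dp_opp (x : dprod X) : dprod X := fun i => - x i.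
Let dp_zero : dprod X := fun i => 0.
Let dp_scale (a : R) (x : dprod X) : dprod X := fun i => a *: x i.

Let dp_addA : associative dp_add.
Proof. by move=> x y z; apply: functional_extensionality_dep => i; exact: addrA. Qed.
Let dp_addC : commutative dp_add.
Proof. by move=> x y; apply: functional_extensionality_dep => i; exact: addrC. Qed.
Let dp_add0 : left_id dp_zero dp_add.
Proof. by move=> x; apply: functional_extensionality_dep => i; exact: add0r. Qed.
Let dp_addN : left_inverse dp_zero dp_opp dp_add.
Proof. by move=> x; apply: functional_extensionality_dep => i; exact: addNr. Qed.

HB.instance Definition _ :=
  GRing.isZmodule.Build (dprod X) dp_addA dp_addC dp_add0 dp_addN.

Let dp_scaleA a b (x : dprod X) : dp_scale a (dp_scale b x) = dp_scale (a * b) x.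
Proof. by apply: functional_extensionality_dep => i; exact: scalerA. Qed.
Let dp_scale1 : left_id 1 dp_scale.
Proof. by move=> x; apply: functional_extensionality_dep => i; exact: scale1r. Qed.
Let dp_scaleDr : right_distributive dp_scale +%R.
Proof. by move=> a x y; apply: functional_extensionality_dep => i; exact: scalerDr. Qed.
Let dp_scaleDl (x : dprod X) : {morph dp_scale^~ x : a b / a + b}.
Proof. by move=> a b; apply: functional_extensionality_dep => i; exact: scalerDl. Qed.

HB.instance Definition _ := GRing.Zmodule_isLmodule.Build R (dprod X)
  dp_scaleA dp_scale1 dp_scaleDr dp_scaleDl.

End DependentProduct.

Section AbsoluteSum.
Context {R : realType} {I : Type} (E : absNormedSpace R I).
Context (X : I -> completeNormedModType R).

Definition norm_fun (x : dprod X) : I -> R := fun i => `|x i|.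

Definition abs_sum_pred : {pred dprod X} := [pred x | norm_fun x \in ns_pred E].

Definition abs_sum_norm (x : dprod X) : R := ns_norm E (norm_fun x).

Let norm_funZ a x : norm_fun (a *: x) = `|a| *: norm_fun x.
Proof. by apply/funext => i; exact: normrZ. Qed.

Let norm_funD x y i : `|norm_fun (x + y) i| <= `|(norm_fun x + norm_fun y) i|.
Proof.
rewrite /norm_fun normr_id [leRHS]ger0_norm; first exact: ler_normD.
exact: addr_ge0.
Qed.

Lemma abs_sum_submod : submod_closed abs_sum_pred.
Proof.
split=> [|a x y].
  rewrite inE; have -> : norm_fun 0 = 0 by apply/funext => i; exact: normr0.
  exact: rpred0.
rewrite !inE => xE yE.
have h : `|a| *: norm_fun x + norm_fun y \in ns_pred E by rewrite rpredD ?rpredZ.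
apply: (proj1 (as_monotone h _)) => i.
by rewrite -norm_funZ; exact: norm_funD.
Qed.

Lemma abs_sum_normD : {in abs_sum_pred &, forall x y,
  abs_sum_norm (x + y) <= abs_sum_norm x + abs_sum_norm y}.
Proof.
move=> x y; rewrite !inE => xE yE; apply: le_trans (ns_normD xE yE).
by apply: (proj2 (as_monotone (rpredD xE yE) _)) => i; exact: norm_funD.
Qed.

Lemma abs_sum_normZ a : {in abs_sum_pred, forall x,
  abs_sum_norm (a *: x) = `|a| * abs_sum_norm x}.
Proof.
by move=> x; rewrite inE => xE; rewrite /abs_sum_norm norm_funZ ns_normZ // normr_id.
Qed.

Lemma abs_sum_norm_eq0 : {in abs_sum_pred, forall x, abs_sum_norm x = 0 -> x = 0}.
Proof.
move=> x; rewrite inE => xE /(ns_norm_eq0 xE) h.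
apply: functional_extensionality_dep => i; apply/eqP; rewrite -normr_eq0.
by apply/eqP; exact: (congr1 (@^~ i) h).
Qed.

Definition abs_sum_normed : normedSubspace (dprod X) :=
  NormedSubspace abs_sum_submod abs_sum_normD abs_sum_normZ abs_sum_norm_eq0.

Lemma abs_sum_complete (F : set_system (ns_type abs_sum_normed)) :
  ProperFilter F -> cauchy F -> cvg F.
Proof.
move: F; apply: complete_of_series => u hu.
have uE n : norm_fun (ns_val (u n)) \in ns_pred E := ns_valP (u n).
pose w : (bs_type E)^nat := fun n => NsType (uE n).
have wN n : `|w n| = `|u n| by [].
have cw : cvgn (series w).
  by apply: (@series_cvg_geom _ _ _ 1) => n; rewrite mul1r wN.
have ui i n : `|ns_val (u n) i| <= 2^-1 ^+ n.
  by apply: le_trans (hu n); have := as_coord_le i (uE n); rewrite normr_id.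
have cx i : cvgn (series (fun n => ns_val (u n) i)).
  by apply: (@series_cvg_geom _ _ _ 1) => n; rewrite mul1r.
pose x : dprod X := fun i => limn (series (fun n => ns_val (u n) i)).
set b := limn (series w) in cw *.
have coord i : ns_val (series w n) i @[n --> \oo] --> ns_val b i.
  apply/cvgrPdist_lt => e e0.
  move/cvgrPdist_lt: cw => /(_ _ e0); apply: filterS => n; apply: le_lt_trans.
  exact: (as_coord_le i (ns_valP (b - series w n))).
have wE n i : ns_val (series w n) i = \sum_(0 <= k < n) `|ns_val (u k) i|.
  by rewrite val_sum fct_sumE.
have key n i : `|x i - \sum_(0 <= k < n) ns_val (u k) i|
    <= `|(ns_val b - ns_val (series w n)) i|.
  apply: (le_trans _ (ler_norm _)).
  have c1 : `|series (fun n => ns_val (u n) i) m - \sum_(0 <= k < n) ns_val (u k) i|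
      @[m --> \oo] --> `|x i - \sum_(0 <= k < n) ns_val (u k) i|.
    by apply: cvg_norm; apply: cvgB; [exact: cx | exact: cvg_cst].
  have c2 : ns_val (series w m) i - ns_val (series w n) i @[m --> \oo]
      --> ns_val b i - ns_val (series w n) i.
    by apply: cvgB; [exact: coord | exact: cvg_cst].
  apply: (ler_cvg_to c1 c2); exists n => // m /= nm.
  rewrite !wE /series /= !(big_cat_nat (leq0n n) nm) /= ![_ + _ - _]addrAC !subrr !add0r.
  exact: ler_norm_sum.
have valS n i : ns_val (series u n) i = \sum_(0 <= k < n) ns_val (u k) i.
  rewrite /series /=; elim: n => [|n ih]; first by rewrite !big_nil.
  by rewrite !big_nat_recr //= -ih.
have xE : x \in abs_sum_pred.
  rewrite inE; apply: (proj1 (as_monotone (ns_valP b) _)) => i.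
  have := key 0%N i; rewrite /norm_fun normr_id big_nil subr0.
  by rewrite /series /= big_nil subr0.
apply/cvg_ex; exists (@NsType R (dprod X) abs_sum_normed x xE).
apply/cvgrPdist_lt => e e0.
move/cvgrPdist_lt: cw => /(_ _ e0); apply: filterS => n; apply: le_lt_trans.
apply: (proj2 (as_monotone (ns_valP (b - series w n)) _)) => i.
rewrite /norm_fun normr_id; apply: le_trans (key n i).
by rewrite -valS.
Qed.

Definition abs_sum : banachSubspace (dprod X) := BanachSubspace abs_sum_complete.

Lemma abs_sum_normE (x : abs_sum) : `|x| = ns_norm E (fun i => `|ns_val x i|).
Proof. by []. Qed.

End AbsoluteSum.

(* Main.v *)
Require Import Defs.
From HB Require Import structures.
From mathcomp Require Import all_boot all_order all_algebra.
From mathcomp Require Import all_classical all_reals all_analysis.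
From mathcomp Require Import lra.
Import Order.TTheory GRing.Theory Num.Theory.
Import numFieldNormedType.Exports.
Local Open Scope classical_set_scope.
Local Open Scope ring_scope.
Set Implicit Arguments.
Unset Strict Implicit.
Unset Printing Implicit Defensive.

(** Write S for the absolute sum, and let x_n, y_n, x be unit vectors of S with
    (x_n + y_n) / 2 --> x, and f_n norm-one functionals with f_n x_n --> 1.

    The space E enters through the vectors of coordinate norms. Put
    a_n = (|x_n(i)|)_i, b_n = (|y_n(i)|)_i, a = (|x(i)|)_i and
    c_n = (|x_n(i) + y_n(i)| / 2)_i, so that c_n --> a in E. By the two triangle
    inequalities |2 c_n - a_n| <= b_n coordinatewise, hence the reflection
    2 a - a_n of a_n in a has norm at most 1 + o(1). As a is the exact midpoint
    of a_n and its reflection, MLUR forces a_n --> a ([norm_vec_cvg]); by symmetry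
    b_n --> a.

    The summands enter one coordinate at a time. Let g_n be the restriction of
    f_n to the i-th summand. Replacing x_n(i) by another vector z of no larger
    norm does not increase the norm of x_n, so g_n z - g_n (x_n(i)) is at most
    1 - f_n x_n, which tends to 0: the functional g_n almost attains its norm at
    x_n(i). Were g_n (x_n(i) - y_n(i)) not to tend to 0, then x(i) would be
    nonzero and the norms of g_n would be bounded below along a subsequence;
    normalising there contradicts the rotundity property of the i-th summand.
    So g_n (x_n(i) - y_n(i)) --> 0 ([acs_for_nearly_norming]).

    Finally a is within e of a vector of E supported on a finite set A of
    indices, so that x_n and y_n have tails off A of norm less than 2 e
    eventually. Hence f_n (x_n - y_n) is, up to 4 e, the sum over A of its
    coordinate contributions, and tends to 0 ([cvg0_of_coords]); therefore
    f_n y_n --> 1.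

    Both properties are treated at once: mluacs is msluacs restricted to constant
    sequences of functionals, and constancy survives every construction above. *)

(** * Sequences in normed spaces *)

Section Limits.
Context {R : realType}.

Lemma cvg0_le (V : normedModType R) (u : V^nat) (d : R^nat) :
  (forall n, `|u n| <= d n) -> d @ \oo --> (0 : R) -> u @ \oo --> (0 : V).
Proof.
move=> ud d0; apply: norm_cvg0.
apply: (squeeze_cvgr _ (cvg_cst (0 : R)) d0).
by apply: nearW => n; rewrite normr_ge0 ud.
Qed.

Lemma cvg_subseq (T : topologicalType) (u : T^nat) (l : T) (phi : nat -> nat) :
  (forall n, n <= phi n)%N -> u @ \oo --> l -> (u \o phi) @ \oo --> l.
Proof.
move=> le_phi ul; apply: cvg_comp ul => A [N _ NA].
by exists N => // n /= Nn; apply: NA; exact: leq_trans Nn (le_phi n).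
Qed.

(** The index map [phi] need not be increasing: [n <= phi n] is all that
    [cvg_subseq] asks for, and it spares a recursive construction. *)
Lemma not_cvg0_subseq (V : normedModType R) (u : V^nat) (P : nat -> Prop) :
  (\forall n \near \oo, P n) -> ~ (u @ \oo --> (0 : V)) ->
  exists2 e : R, 0 < e & exists2 phi : nat -> nat, (forall n, n <= phi n)%N &
    forall n, P (phi n) /\ e <= `|u (phi n)|.
Proof.
move=> [N0 _ hP] /cvgr0Pnorm_lt/existsNP[e /not_implyP[e0 hN]].
exists e => //.
suff /choice[phi hphi] : forall n, exists m, (n <= m)%N /\ (P m /\ e <= `|u m|).
  by exists phi => n; have [] := hphi n.
move=> n; apply: contrapT => nm; apply: hN.
exists (maxn N0 n) => // m /=; rewrite geq_max => /andP[N0m nlem].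
rewrite ltNge; apply/negP => eu; apply: nm; exists m; split => //.
by split => //; apply: hP.
Qed.

Lemma normr_normalise (V : normedModType R) (v : V) : v != 0 ->
  `| `|v|^-1 *: v | = 1.
Proof. by move=> v0; rewrite normrZV // unitfE normr_eq0. Qed.

End Limits.

(** * Bounded functionals and their dual norm *)

(** The supremum defining [dual_norm] is meaningful only for bounded functionals;
    an explicit bound is assumed wherever it has to be an upper bound. *)
Section DualNorm.
Context {R : realType}.
Implicit Types X : completeNormedModType R.

Lemma dual_norm_has_ub X (f : {linear X -> R^o}) (C : R) :
  (forall z, `|f z| <= C * `|z|) ->
  has_ubound [set `|f x| | x in [set x : X | `|x| <= 1]].
Proof.
move=> fC; exists `|C| => _ [x /= x1 <-]; apply: le_trans (fC x) _.
apply: le_trans (ler_norm _) _; rewrite normrM normr_id ler_piMr //.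
Qed.

Lemma dual_norm_ge X (f : {linear X -> R^o}) (C : R) :
  (forall z, `|f z| <= C * `|z|) -> forall z, `|f z| <= dual_norm f * `|z|.
Proof.
move=> fC z; have [->|z0] := eqVneq z 0; first by rewrite linear0 !normr0 mulr0.
have z1 := normr_normalise z0.
rewrite -ler_pdivrMr ?normr_gt0 //.
have -> : `|f z| / `|z| = `|f (`|z|^-1 *: z)|.
  by rewrite linearZ /= normrM normfV normr_id mulrC.
by apply: (ub_le_sup (dual_norm_has_ub fC)); exists (`|z|^-1 *: z) => //=; rewrite z1.
Qed.

(** One-sided bounds suffice, the unit ball being symmetric. *)
Lemma dual_norm_le X (f : {linear X -> R^o}) (t : R) :
  (forall z, `|z| <= 1 -> f z <= t) -> dual_norm f <= t.
Proof.
move=> ft; apply: ge_sup; first by exists `|f 0|, 0 => //=; rewrite normr0.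
move=> _ [z /= z1 <-]; rewrite ler_norml ft // andbT lerNl -linearN ft //.
by rewrite normrN.
Qed.

Lemma dual_norm_ge0 X (f : {linear X -> R^o}) (C : R) :
  (forall z, `|f z| <= C * `|z|) -> 0 <= dual_norm f.
Proof.
move=> fC; apply: (ub_le_sup (dual_norm_has_ub fC)).
by exists 0 => /=; rewrite ?linear0 normr0.
Qed.

Lemma dual_sphere_le X (f : {linear X -> R^o}) :
  @dual_sphere R X f -> forall z, `|f z| <= `|z|.
Proof.
move=> [cf f1] z; have := continuous_linear_bounded 0 (cf 0).
move=> /linear_boundedP/pinfty_ex_gt0[C _ fC].
by have := dual_norm_ge fC z; rewrite f1 mul1r.
Qed.

Lemma dual_sphere_normalise X (f : {linear X -> R^o}) :
  (forall z, `|f z| <= `|z|) -> 0 < dual_norm f ->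
  @dual_sphere R X ((dual_norm f)^-1 \*: f).
Proof.
move=> f1 Nf.
have fC z : `|f z| <= 1 * `|z| by rewrite mul1r.
have hge := dual_norm_ge fC.
set h : {linear X -> R^o} := (dual_norm f)^-1 \*: f.
have h1 z : `|h z| <= 1 * `|z|.
  rewrite mul1r /h /= normrZ ger0_norm ?invr_ge0 ?(ltW Nf) // mulrC.
  by rewrite ler_pdivrMr // mulrC.
split.
  apply: bounded_linear_continuous; apply/linear_boundedP.
  exists 1; split=> // r r1 z; apply: le_trans (h1 z) _.
  by rewrite ler_wpM2r // ltW.
apply/eqP; rewrite eq_le; apply/andP; split.
  apply: dual_norm_le => z z1; apply: le_trans (ler_norm _) _.
  by apply: le_trans (h1 z) _; rewrite mul1r.
rewrite -(ler_pM2l Nf) mulr1; apply: dual_norm_le => z z1.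
have -> : f z = dual_norm f * h z.
  by rewrite /h /= -[_ *: f z]/(_ * f z) mulrA divff ?mul1r // gt_eqF.
rewrite ler_pM2l //; apply: le_trans (ler_norm _) _.
apply: le_trans (dual_norm_ge h1 z) _; rewrite ler_piMr //.
exact: dual_norm_ge0 h1.
Qed.

End DualNorm.

(** * A common form of the two rotundity properties *)

Section UniformAcs.
Context {R : realType}.
Implicit Types X : completeNormedModType R.

(** The proposition [cst] switches between the two properties: with [cst := True]
    only constant sequences of functionals are admitted, with [cst := False] all
    of them are. *)
Definition acs_for (cst : Prop) X : Prop :=
  forall (x_ y_ : X^nat) (x : X) (f_ : nat -> {linear X -> R^o}),
    (forall n, `|x_ n| = 1) -> (forall n, `|y_ n| = 1) -> `|x| = 1 ->
    (forall n, @dual_sphere R X (f_ n)) -> (cst -> forall n, f_ n = f_ 0%N) ->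
    midpoint_cvg x_ y_ x ->
    f_ n (x_ n) @[n --> \oo] --> (1 : R) ->
    f_ n (y_ n) @[n --> \oo] --> (1 : R).

Lemma acs_for_msluacs X : acs_for False X <-> msluacs X.
Proof.
split=> H x_ y_ x f_ x1 y1 xx f1; first exact: H.
by move=> _; exact: H.
Qed.

Lemma acs_for_mluacs X : acs_for True X <-> mluacs X.
Proof.
split=> H x_ y_ x f_ x1 y1 xx f1.
  exact: (H x_ y_ x (fun=> f_)).
move=> /(_ Logic.I) fE; have -> : f_ = fun=> f_ 0%N by apply/funext.
exact: H.
Qed.

Lemma midpoint_cvgP X (x_ y_ : X^nat) x :
  midpoint_cvg x_ y_ x <-> (fun n => 2^-1 *: (x_ n + y_ n)) @ \oo --> x.
Proof.
rewrite /midpoint_cvg; split=> h.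
  rewrite -[X in _ --> X]subr0.
  have -> : (fun n => 2^-1 *: (x_ n + y_ n)) =
      (fun n => x - (x - 2^-1 *: (x_ n + y_ n))).
    by apply/funext => n; rewrite subKr.
  by apply: cvgB; [exact: cvg_cst|exact: norm_cvg0].
rewrite -(@normr0 _ X); apply: cvg_norm.
by rewrite -(subrr x); apply: cvgB => //; exact: cvg_cst.
Qed.

(** The correction made by normalising [x_ n] is
    [(`|x_ n|^-1 - `|x|^-1) *: x_ n], of norm [`|1 - `|x_ n| / `|x| |]. *)
Lemma midpoint_normalise X (x_ y_ : X^nat) (x : X) : x != 0 ->
  (forall n, x_ n != 0) -> (forall n, y_ n != 0) ->
  (fun n => `|x_ n|) @ \oo --> `|x| -> (fun n => `|y_ n|) @ \oo --> `|x| ->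
  midpoint_cvg x_ y_ x ->
  midpoint_cvg (fun n => `|x_ n|^-1 *: x_ n) (fun n => `|y_ n|^-1 *: y_ n)
    (`|x|^-1 *: x).
Proof.
move=> x0 xn0 yn0 cx cy /midpoint_cvgP m; apply/midpoint_cvgP.
set s := `|x| in cx cy *.
have s0 : s != 0 by rewrite normr_eq0.
have corr (z_ : X^nat) : (forall n, z_ n != 0) -> (fun n => `|z_ n|) @ \oo --> s ->
    (fun n => (`|z_ n|^-1 - s^-1) *: z_ n) @ \oo --> (0 : X).
  move=> zn0 cz; apply: (@cvg0_le _ _ _ (fun n => `|1 - s^-1 * `|z_ n| |)).
    move=> n; rewrite normrZ -{2}[`|z_ n|]normr_id -normrM mulrBl mulVf //.
    by rewrite normr_eq0.
  rewrite -(@normr0 _ R) -(subrr (1 : R)); apply: cvg_norm; apply: cvgB.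
    exact: cvg_cst.
  by rewrite -(mulVf s0); apply: cvgM => //; exact: cvg_cst.
have -> : (fun n => 2^-1 *: (`|x_ n|^-1 *: x_ n + `|y_ n|^-1 *: y_ n)) =
  (fun n => s^-1 *: (2^-1 *: (x_ n + y_ n)) +
     2^-1 *: ((`|x_ n|^-1 - s^-1) *: x_ n + (`|y_ n|^-1 - s^-1) *: y_ n)).
  apply/funext => n; rewrite [s^-1 *: _]scalerA mulrC -scalerA -scalerDr.
  congr (_ *: _); rewrite scalerDr !scalerBl addrACA.
  by rewrite ![s^-1 *: _ + _]addrC !subrK.
rewrite -[X in _ --> X]addr0; apply: cvgD; first by apply: cvgZr.
rewrite -(scaler0 _ (2^-1 : R)); apply: cvgZr.
by rewrite -(addr0 (0 : X)); apply: cvgD; apply: corr.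
Qed.

(** The rotundity property is about unit vectors and norm-one functionals, but it
    extends to vectors of converging norms and functionals of norm at most 1,
    where the hypothesis that the functional tends to 1 on [x_] becomes: [g_ n]
    is within [d n] of its maximum on the ball of radius [`|x_ n|] at [x_ n].
    If the conclusion failed, it would fail by a fixed amount [e] along a
    subsequence; there the norm of [g_ n] is bounded below, so that dividing by
    it keeps the error small, and the rotundity property is contradicted. *)
Lemma acs_for_nearly_norming (cst : Prop) X (x_ y_ : X^nat) (x : X)
    (g_ : nat -> {linear X -> R^o}) (d : R^nat) :
  acs_for cst X ->
  (forall n z, `|g_ n z| <= `|z|) -> (cst -> forall n, g_ n = g_ 0%N) ->
  (fun n => `|x_ n|) @ \oo --> `|x| -> (fun n => `|y_ n|) @ \oo --> `|x| ->
  midpoint_cvg x_ y_ x ->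
  (forall n z, `|z| <= `|x_ n| -> g_ n z - g_ n (x_ n) <= d n) ->
  d @ \oo --> (0 : R) ->
  (fun n => g_ n (x_ n - y_ n) : R) @ \oo --> (0 : R).
Proof.
move=> H g1 gcst cx cy mid gd d0.
have [x0|x0] := eqVneq x 0.
  apply: (@cvg0_le _ _ _ (fun n => `|x_ n| + `|y_ n|)).
    by move=> n; apply: le_trans (g1 _ _) _; exact: ler_normB.
  rewrite x0 normr0 in cx cy.
  by rewrite -[X in _ --> X]addr0; exact: cvgD.
set s := `|x| in cx cy *.
have s0 : 0 < s by rewrite normr_gt0.
apply: contrapT.
have nearP : \forall n \near \oo, [/\ s / 2 < `|x_ n|, 0 < `|y_ n|
    & `|x_ n| + `|y_ n| < 3 * s].
  have h1 : s / 2 < s by lra.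
  have h2 : s + s < 3 * s by lra.
  near=> n; split; near: n.
  - exact: (cvgr_gt s).
  - exact: (cvgr_gt s).
  - by apply: (cvgr_lt (s + s)) => //; exact: cvgD.
move=> /(not_cvg0_subseq nearP)[e e0 [phi le_phi hphi]].
have xlow n : s / 2 < `|x_ (phi n)| by have [[]] := hphi n.
have ylow n : 0 < `|y_ (phi n)| by have [[]] := hphi n.
have xgt n : 0 < `|x_ (phi n)| by apply: lt_trans (xlow n); rewrite divr_gt0.
have xy n : `|x_ (phi n)| + `|y_ (phi n)| < 3 * s by have [[]] := hphi n.
have far n : e <= `|g_ (phi n) (x_ (phi n) - y_ (phi n))| by have [] := hphi n.
pose g n := g_ (phi n); pose N n := dual_norm (g n).
have g1' n z : `|g n z| <= 1 * `|z| by rewrite mul1r; exact: g1.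
have gN n z := dual_norm_ge (g1' n) z.
have N0 n : 0 <= N n := dual_norm_ge0 (g1' n).
have N1 n : N n <= 1.
  apply: dual_norm_le => z z1; apply: le_trans (ler_norm _) _.
  by apply: le_trans (g1 _ _) _.
(* [g n] takes a value of modulus at least [e] on a vector of norm at most [3 * s]. *)
pose k := e / (3 * s).
have k0 : 0 < k by rewrite divr_gt0 // mulr_gt0.
have Nk n : k <= N n.
  rewrite /k ler_pdivrMr ?mulr_gt0 //; apply: le_trans (far n) _.
  apply: le_trans (gN n _) _; apply: ler_wpM2l; first exact: N0.
  by apply: le_trans (ler_normB _ _) _; exact: ltW.
have Ngt n : 0 < N n := lt_le_trans k0 (Nk n).
pose h n : {linear X -> R^o} := (N n)^-1 \*: g n.
have hS n : @dual_sphere R X (h n).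
  by apply: dual_sphere_normalise (Ngt n) => z; exact: g1.
pose u n := `|x_ (phi n)|^-1 *: x_ (phi n).
pose v n := `|y_ (phi n)|^-1 *: y_ (phi n).
have u1 n : `|u n| = 1 by apply: normr_normalise; rewrite -normr_gt0.
have v1 n : `|v n| = 1 by apply: normr_normalise; rewrite -normr_gt0.
have gh n z : g n z = N n * h n z.
  by rewrite /h /= -[_ *: g n z]/(_ * g n z) mulrA divff ?mul1r // gt_eqF.
have gx n : g n (x_ (phi n)) = `|x_ (phi n)| * g n (u n).
  by rewrite /u linearZ /= -[_ *: g n _]/(_ * g n _) mulrA divff ?mul1r // gt_eqF.
have gy n : g n (y_ (phi n)) = `|y_ (phi n)| * g n (v n).
  by rewrite /v linearZ /= -[_ *: g n _]/(_ * g n _) mulrA divff ?mul1r // gt_eqF.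
have cx' : (fun n => `|x_ (phi n)|) @ \oo --> s.
  exact: (cvg_subseq le_phi cx).
have cy' : (fun n => `|y_ (phi n)|) @ \oo --> s.
  exact: (cvg_subseq le_phi cy).
(* Dividing [N n * `|x_| <= d + g n x_] by [N n * `|x_|], which is at least
   [k * (s / 2)], bounds [h n (u n)] below. *)
have hu : (fun n => h n (u n) : R) @ \oo --> (1 : R).
  apply: (@squeeze_cvgr _ _ _ _ (fun n => 1 - (k * (s / 2))^-1 * d (phi n)) (fun=> 1)).
  - apply: nearW => n; apply/andP; split; last first.
      apply: le_trans (ler_norm _) _.
      by apply: le_trans (dual_sphere_le (hS n) _) _; rewrite u1.
    have Nx : N n * `|x_ (phi n)| <= d (phi n) + g n (x_ (phi n)).
      rewrite -ler_pdivlMr //; apply: dual_norm_le => z z1.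
      rewrite ler_pdivlMr // -lerBlDr.
      have := gd (phi n) (`|x_ (phi n)| *: z).
      rewrite linearZ /= -[_ *: g_ _ _]/(_ * g_ _ _) mulrC; apply.
      by rewrite normrZ normr_id ler_piMr.
    rewrite gx gh mulrCA mulrA in Nx.
    have Nx0 : 0 < N n * `|x_ (phi n)| by rewrite mulr_gt0.
    have dge : 0 <= d (phi n).
      by apply: le_trans (gd (phi n) (x_ (phi n)) (lexx _)); rewrite subrr.
    have : (k * (s / 2)) <= N n * `|x_ (phi n)|.
      by apply: ler_pM => //; [exact: ltW|rewrite divr_ge0 // ltW|exact: ltW].
    have ks0 : 0 < k * (s / 2) by rewrite mulr_gt0 // divr_gt0.
    move=> kle; rewrite lerBlDr -lerBlDl -(ler_pM2l Nx0) mulrBr mulr1.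
    apply: (@le_trans _ _ (d (phi n))); first by lra.
    by rewrite mulrA ler_peMl // ler_pdivlMr // mul1r.
  - rewrite -[X in _ --> X]subr0 -[X in _ - X](mulr0 (k * (s / 2))^-1).
    apply: cvgB; first exact: cvg_cst.
    apply: cvgM; first exact: cvg_cst.
    exact: (cvg_subseq le_phi d0).
  - exact: cvg_cst.
have hv : (fun n => h n (v n) : R) @ \oo --> (1 : R).
  apply: (H u v (s^-1 *: x)) => //.
  - exact: normr_normalise.
  - by move=> c n; rewrite /h /N /g (gcst c (phi n)) (gcst c (phi 0%N)).
  - apply: midpoint_normalise => //.
    + by move=> n; rewrite -normr_gt0.
    + by move=> n; rewrite -normr_gt0.
    + exact: (cvg_subseq le_phi mid).
have lim0 : (fun n => `|x_ (phi n)| * h n (u n) - `|y_ (phi n)| * h n (v n) : R)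
    @ \oo --> (0 : R).
  by rewrite -(subrr (s * 1)); apply: cvgB; apply: cvgM.
have /cvgr0_norm_lt/(_ e e0)[M _ /(_ M (leqnn M))/=] := lim0.
apply/negP; rewrite -leNgt; apply: le_trans (far M) _.
have -> : g_ (phi M) (x_ (phi M) - y_ (phi M)) =
    N M * (`|x_ (phi M)| * h M (u M) - `|y_ (phi M)| * h M (v M)).
  by rewrite linearB -/(g M) gx gy !(gh M) mulrBr; congr (_ - _); exact: mulrCA.
by rewrite normrM (ger0_norm (N0 M)) ler_piMl.
Unshelve. all: by end_near.
Qed.

End UniformAcs.

(** * Midpoint local uniform rotundity and coordinate norms *)

Section Midpoint.
Context {R : realType}.

(** The vector [a] is the midpoint of [u_ n] and its reflection
    [v n = 2 *: a - u_ n]. Since [`|v n| >= 2 - 1], the hypothesis puts [`|v n|]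
    between 1 and [1 + e_ n], so normalising [v n] moves the midpoint by at most
    [e_ n / 2]. *)
Lemma MLUR_reflection (X : completeNormedModType R) (u_ : X^nat) (a : X)
    (e_ : R^nat) :
  MLUR X -> (forall n, `|u_ n| = 1) -> `|a| = 1 ->
  (forall n, `|2 *: a - u_ n| <= 1 + e_ n) -> e_ @ \oo --> (0 : R) ->
  u_ @ \oo --> a.
Proof.
move=> H u1 a1 ue e0; pose v n := 2 *: a - u_ n.
have vge n : 1 <= `|v n|.
  have := ler_normD (v n) (u_ n); rewrite subrK u1 normrZ a1 ger0_norm //; lra.
have vn0 n : v n != 0 by rewrite -normr_gt0; apply: lt_le_trans (vge n).
pose v' n := `|v n|^-1 *: v n.
have vv' n : `|v n - v' n| <= e_ n.
  rewrite /v' -{1}[v n]scale1r -scalerBl normrZ -{2}[`|v n|]normr_id -normrM.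
  rewrite mulrBl mul1r mulVf ?normr_eq0 // ger0_norm ?subr_ge0 //.
  by rewrite lerBlDl; exact: ue.
have uv n : 2^-1 *: (u_ n + v n) = a.
  by rewrite addrC subrK scalerA mulVf ?scale1r // pnatr_eq0.
have : `|u_ n - v' n| @[n --> \oo] --> (0 : R).
  apply: (H u_ v' a) => //; first by move=> n; exact: normr_normalise.
  apply: (@cvg0_le _ _ _ e_) => // n; rewrite normr_id.
  have -> : a - 2^-1 *: (u_ n + v' n) = 2^-1 *: (v n - v' n).
    by rewrite -[a in LHS](uv n) -scalerBr [u_ n + v n]addrC addrKA.
  rewrite normrZ ger0_norm ?invr_ge0 //.
  by have := vv' n; have := normr_ge0 (v n - v' n); lra.
move=> uv'0; rewrite -[X in _ --> X]addr0.
have -> : u_ = (fun n => a + (u_ n - a)) by apply/funext => n; rewrite subrKC.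
apply: cvgD; first exact: cvg_cst.
apply: (@cvg0_le _ _ _ (fun n => `|u_ n - v' n| + e_ n)); last first.
  by rewrite -[X in _ --> X]addr0; apply: cvgD.
move=> n.
have -> : u_ n - a = 2^-1 *: ((u_ n - v' n) - (v n - v' n)).
  rewrite opprB addrA subrK; apply/eqP; rewrite subr_eq -[X in _ + X](uv n).
  rewrite -scalerDr addrACA addNr addr0 scalerDr -scalerDl.
  have -> : (2^-1 + 2^-1 : R) = 1 by lra.
  by rewrite scale1r.
rewrite normrZ ger0_norm ?invr_ge0 //.
have := ler_normB (u_ n - v' n) (v n - v' n); have := vv' n.
have := normr_ge0 (u_ n - v' n); have := normr_ge0 (v n - v' n); lra.
Qed.

End Midpoint.

Section AbsSum.
Context {R : realType} {I : Type} (E : absNormedSpace R I).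
Context (X : I -> completeNormedModType R).
Local Notation S := (abs_sum E X).
Implicit Types (v w : S) (A : set I).

Lemma as_norm_le (p q : E) :
  (forall i, `|ns_val p i| <= `|ns_val q i|) -> `|p| <= `|q|.
Proof. by move=> pq; exact: (proj2 (as_monotone (ns_valP q) pq)). Qed.

Definition norm_vec w : E := NsType (ns_valP w : norm_fun (ns_val w) \in ns_pred E).

Lemma norm_vecN w : `|norm_vec w| = `|w|. Proof. by []. Qed.

Lemma abs_sum_le v w :
  (forall i, `|ns_val v i| <= `|ns_val w i|) -> `|v| <= `|w|.
Proof.
by move=> vw; rewrite -!norm_vecN; apply: as_norm_le => i; rewrite !normr_id.
Qed.

Lemma abs_sum_coord w i : `|ns_val w i| <= `|w|.
Proof. by have := as_coord_le i (ns_valP (norm_vec w)); rewrite normr_id. Qed.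

Lemma norm_vecB v w : `|norm_vec v - norm_vec w| <= `|v - w|.
Proof.
rewrite -(norm_vecN (v - w)); apply: as_norm_le => i.
by rewrite normr_id; exact: ler_dist_dist.
Qed.

(** Coordinatewise, with [p], [q] the coordinates of [x_ n], [y_ n], the bound
    [`| `|p + q| - `|p| | <= `|q|] says that reflecting the norms of [x_ n] in
    those of the midpoint gives a vector dominated by the norms of [y_ n]. *)
Lemma norm_vec_cvg (x_ y_ : S^nat) (x : S) : MLUR E ->
  (forall n, `|x_ n| = 1) -> (forall n, `|y_ n| = 1) -> `|x| = 1 ->
  midpoint_cvg x_ y_ x -> (fun n => norm_vec (x_ n)) @ \oo --> norm_vec x.
Proof.
move=> H x1 y1 xx mid.
pose c n := norm_vec (2^-1 *: (x_ n + y_ n)).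
pose r n := `|x - 2^-1 *: (x_ n + y_ n)|.
apply: (@MLUR_reflection _ E _ _ (fun n => 2 * r n)) => //; last first.
  by rewrite -(mulr0 (2 : R)); apply: cvgM => //; exact: cvg_cst.
move=> n.
have -> : 2 *: norm_vec x - norm_vec (x_ n) =
    (2 *: c n - norm_vec (x_ n)) + 2 *: (norm_vec x - c n).
  by rewrite scalerBr [RHS]addrC subrKA.
apply: le_trans (ler_normD _ _) _; apply: lerD; last first.
  by rewrite normrZ ger0_norm // ler_pM2l // norm_vecB.
rewrite -[leRHS](y1 n) -norm_vecN; apply: as_norm_le => i.
rewrite [leRHS]normr_id.
set p := ns_val (x_ n) i; set q := ns_val (y_ n) i.
have cE : 2 * ns_val (c n) i = `|p + q|.
  have -> : ns_val (c n) i = `|2^-1 *: (p + q)| by [].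
  by rewrite normrZ mulrA ger0_norm ?invr_ge0 // mulfV ?mul1r // pnatr_eq0.
have vE : ns_val (2 *: c n - norm_vec (x_ n)) i = 2 * ns_val (c n) i - `|p| by [].
suff le_q : `|2 * ns_val (c n) i - `|p| | <= `|q| by exact: le_q.
rewrite cE.
rewrite ler_norml; have := ler_normD p q; have := lerB_normD p q.
by move=> h1 h2; apply/andP; split; lra.
Qed.

End AbsSum.

(** * Coordinates and finite restrictions in an absolute sum *)

Section Coordinates.
Context {R : realType} {I : Type} (E : absNormedSpace R I).
Context (X : I -> completeNormedModType R).
Local Notation S := (abs_sum E X).
Implicit Types (v w : S) (A : set I).

Lemma abs_sum_eq v w : (forall i, ns_val v i = ns_val w i) -> v = w.
Proof. by move=> vw; apply: val_inj; apply: functional_extensionality_dep. Qed.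

Definition single_fun i (z : X i) : dprod X := fun j =>
  if pselect (i = j) is left ij then ecast j (X j) ij z else 0.

Lemma single_fun_id i (z : X i) : single_fun z i = z.
Proof.
by rewrite /single_fun; case: pselect => // ii; rewrite (Prop_irrelevance ii erefl).
Qed.

Lemma single_fun_neq i (z : X i) j : i <> j -> single_fun z j = 0.
Proof. by rewrite /single_fun; case: pselect. Qed.

Lemma norm_single_fun i (z : X i) :
  norm_fun (single_fun z) = `|z| *: (\1_[set i] : I -> R).
Proof.
apply/funext => j; rewrite /norm_fun -[RHS]/(`|z| * \1_[set i] j) indicE.
have [ij|ij] := pselect (i = j).
  by case: j / ij; rewrite single_fun_id mem_set // mulr1.
by rewrite single_fun_neq // normr0 memNset ?mulr0 // => /= ji; apply: ij.
Qed.

Lemma single_funP i (z : X i) : single_fun z \in ns_pred S.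
Proof.
have zE : `|z| *: (\1_[set i] : I -> R) \in ns_pred E.
  by apply: rpredZ; exact: as_unit_subproof.
by rewrite -norm_single_fun in zE.
Qed.

Definition single i (z : X i) : S := NsType (single_funP z).

Lemma single_id i (z : X i) : ns_val (single z) i = z.
Proof. exact: single_fun_id. Qed.

Lemma single_neq i (z : X i) j : i <> j -> ns_val (single z) j = 0.
Proof. exact: single_fun_neq. Qed.

Lemma single_is_linear i : linear (@single i).
Proof.
move=> a y z; apply: abs_sum_eq => j.
rewrite -[RHS]/(a *: ns_val (single y) j + ns_val (single z) j).
have [ij|ij] := pselect (i = j); first by case: j / ij; rewrite !single_id.
by rewrite !single_neq // scaler0 addr0.
Qed.

HB.instance Definition _ i :=
  GRing.isLinear.Build R (X i) S *:%R (@single i) (@single_is_linear i).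

Lemma norm_single i (z : X i) : `|single z| = `|z|.
Proof.
rewrite abs_sum_normE -[X in ns_norm _ X]/(norm_fun (single_fun z)).
rewrite norm_single_fun (ns_normZ _ (as_unit_subproof E i)) as_normalised mulr1.
by rewrite normr_id.
Qed.

(** This is what makes a functional that almost attains its norm at [w] do so in
    every coordinate of [w]. *)
Lemma norm_replace w i (z : X i) : `|z| <= `|ns_val w i| ->
  `|w + single (z - ns_val w i)| <= `|w|.
Proof.
move=> zw; apply: abs_sum_le => j.
rewrite -[X in `|X| <= _]/(ns_val w j + ns_val (single (z - ns_val w i)) j).
have [ij|ij] := pselect (i = j); first by case: j / ij; rewrite single_id subrKC.
by rewrite single_neq // addr0.
Qed.

Definition restrict_fun A w : dprod X :=
  fun i => if `[< A i >] then ns_val w i else 0.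

Lemma restrict_funP A w : restrict_fun A w \in ns_pred S.
Proof.
apply: (proj1 (as_monotone (ns_valP (norm_vec w)) _)) => i.
rewrite /norm_fun /restrict_fun !normr_id.
by case: ifP => // _; rewrite normr0.
Qed.

Definition restrict A w : S := NsType (restrict_funP A w).

Lemma restrictE A w i :
  ns_val (restrict A w) i = if `[< A i >] then ns_val w i else 0.
Proof. by []. Qed.

Lemma restrictB A v w : restrict A (v - w) = restrict A v - restrict A w.
Proof.
apply: abs_sum_eq => i.
rewrite -[RHS]/(ns_val (restrict A v) i - ns_val (restrict A w) i) !restrictE.
by case: ifP => // _; rewrite subr0.
Qed.

Lemma restrict0 w : restrict set0 w = 0.
Proof. by apply: abs_sum_eq => i; rewrite restrictE asboolF. Qed.

Lemma restrictU1 A i w : ~ A i ->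
  restrict (i |` A) w = single (ns_val w i) + restrict A w.
Proof.
move=> Ai; apply: abs_sum_eq => j.
rewrite -[RHS]/(ns_val (single (ns_val w i)) j + ns_val (restrict A w) j).
rewrite !restrictE; have [ij|ij] := pselect (i = j).
  by case: j / ij; rewrite single_id asboolT ?asboolF ?addr0 //; left.
rewrite single_neq // add0r; congr (if _ then _ else _).
by apply: asbool_equiv_eq; split=> [[ji|]|] //; [case: ij|right].
Qed.

(** Off [A] the coordinates of [norm_vec w] and of [norm_vec w - p] agree. *)
Lemma norm_restrict_compl A w (p : E) :
  (forall i, ~ A i -> ns_val p i = 0) -> `|w - restrict A w| <= `|norm_vec w - p|.
Proof.
move=> pA; rewrite -norm_vecN; apply: as_norm_le => i; rewrite normr_id.
rewrite -[X in `|X| <= _]/(ns_val w i - ns_val (restrict A w) i) restrictE.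
rewrite -[X in _ <= `|X| ]/(`|ns_val w i| - ns_val p i).
case: asboolP => Ai; first by rewrite subrr normr0.
by rewrite pA // !subr0 normr_id.
Qed.

End Coordinates.

(** * Finite supports *)

Section FiniteRange.

Lemma range_ord_ind (T : Type) (P : set T -> Prop) :
  P set0 -> (forall A x, ~ A x -> P A -> P (x |` A)) ->
  forall n (h : 'I_n -> T), P (range h).
Proof.
move=> P0 PU; elim=> [|n ih] h.
  suff -> : range h = set0 by [].
  by apply/seteqP; split=> // x [[]].
have -> : range h = h ord0 |` range (h \o lift ord0).
  apply/seteqP; split=> x.
    move=> [i _ <-]; have [j ->|->] := unliftP ord0 i; last by left.
    by right; exists j.
  by move=> [->|[j _ <-]]; [exists ord0|exists (lift ord0 j)].
have [hx|hx] := pselect (range (h \o lift ord0) (h ord0)); last exact: PU.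
suff -> : h ord0 |` range (h \o lift ord0) = range (h \o lift ord0) by [].
by apply/setUidr => x ->.
Qed.

Lemma lin_span_unit_support (R : realType) (I : Type) (E : absNormedSpace R I)
    (p : E) : lin_span (range (as_unit E)) p ->
  exists n (h : 'I_n -> I), forall i, ~ range h i -> ns_val p i = 0.
Proof.
move=> [n [c [u [uE ->]]]].
have /choice[h hu] k : exists i, as_unit E i = u k.
  by have [i _ <-] := uE k; exists i.
exists n, h => i hi.
apply: (big_ind (fun q : E => ns_val q i = 0)) => //.
  move=> q r q0 r0; rewrite -[LHS]/(ns_val q i + ns_val r i) q0 r0; exact: addr0.
move=> k _; rewrite -hu.
rewrite -[LHS]/(c k * \1_[set h k] i) indicE memNset ?mulr0 // => /= ih.
by apply: hi; exists k.
Qed.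

End FiniteRange.

(** * Passage from the summands to the sum *)

Section Main.
Context {R : realType} {I : Type} (E : absNormedSpace R I).
Context (X : I -> completeNormedModType R).
Local Notation S := (abs_sum E X).

(** Convergence of the coordinate contributions handles any finite set of
    coordinates; the tails are uniformly small because the norms of [x_ n] and of
    [y_ n] converge in E to the same vector [a], which is nearly finitely
    supported. *)
Lemma cvg0_of_coords (x_ y_ : S^nat) (a : E) (f_ : nat -> {linear S -> R^o}) :
  dense (lin_span (range (as_unit E))) ->
  (forall n z, `|f_ n z| <= `|z|) ->
  (fun n => norm_vec (x_ n)) @ \oo --> a -> (fun n => norm_vec (y_ n)) @ \oo --> a ->
  (forall i, (fun n => f_ n (single E (ns_val (x_ n - y_ n) i)) : R)
     @ \oo --> (0 : R)) ->
  (fun n => f_ n (x_ n - y_ n) : R) @ \oo --> (0 : R).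
Proof.
move=> E_dense f1 cx cy coord.
have fin n (h : 'I_n -> I) :
    (fun k => f_ k (restrict (range h) (x_ k - y_ k)) : R) @ \oo --> (0 : R).
  apply: (@range_ord_ind _ (fun A =>
    (fun k => f_ k (restrict A (x_ k - y_ k)) : R) @ \oo --> (0 : R))).
    have -> : (fun k => f_ k (restrict set0 (x_ k - y_ k))) = (fun=> 0).
      by apply/funext => k; rewrite restrict0 linear0.
    exact: cvg_cst.
  move=> A i Ai cA.
  have -> : (fun k => f_ k (restrict (i |` A) (x_ k - y_ k))) =
     (fun k => f_ k (single E (ns_val (x_ k - y_ k) i))
               + f_ k (restrict A (x_ k - y_ k))).
    by apply/funext => k; rewrite restrictU1 // linearD.
  by rewrite -(addr0 (0 : R)); apply: cvgD; [exact: coord|exact: cA].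
apply/cvgr0Pnorm_lt => e e0.
have e5 : 0 < e / 5 by rewrite divr_gt0.
have [p [pa /lin_span_unit_support[n [h ph]]]] :
    exists p : E, `|a - p| < e / 5 /\ lin_span (range (as_unit E)) p.
  have [] := E_dense (ball a (e / 5)).
  - by exists a; exact: ballxx.
  - exact: ball_open.
  - by move=> p [pa sp]; exists p; split=> //; rewrite -ball_normE in pa.
have near_p (z_ : S^nat) : (fun n => norm_vec (z_ n)) @ \oo --> a ->
    \forall k \near \oo, `|z_ k - restrict (range h) (z_ k)| < 2 * (e / 5).
  move=> /cvgrPdist_lt/(_ _ e5); apply: filterS => k hk.
  apply: le_lt_trans (norm_restrict_compl _ ph) _.
  by have := ler_distD a (norm_vec (z_ k)) p; rewrite (distrC _ a); lra.
have := fin n h => /cvgr0_norm_lt/(_ _ e5) fh.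
have := near_p _ cx => nx; have := near_p _ cy => ny.
near=> k.
have hx : `|x_ k - restrict (range h) (x_ k)| < 2 * (e / 5) by near: k.
have hy : `|y_ k - restrict (range h) (y_ k)| < 2 * (e / 5) by near: k.
have hf : `|f_ k (restrict (range h) (x_ k - y_ k)) : R| < e / 5 by near: k.
set v := x_ k - restrict (range h) (x_ k) in hx *.
set w := y_ k - restrict (range h) (y_ k) in hy *.
have -> : x_ k - y_ k = restrict (range h) (x_ k - y_ k) + (v - w).
  have -> : v - w = (x_ k - y_ k) - restrict (range h) (x_ k - y_ k).
    by rewrite restrictB !opprD addrACA.
  by rewrite subrKC.
rewrite linearD; apply: le_lt_trans (ler_normD _ _) _.
have h3 := le_trans (f1 k (v - w)) (ler_normB v w).
apply: lt_le_trans (ltr_leD hf h3) _; lra.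
Unshelve. all: by end_near.
Qed.

(** The error [1 - f_ n (x_ n)] serves as the defect [d] in every coordinate. *)
Lemma abs_sum_acs_for (cst : Prop) :
  dense (lin_span (range (as_unit E))) -> MLUR E ->
  (forall i, acs_for cst (X i)) -> acs_for cst S.
Proof.
move=> E_dense E_MLUR HX x_ y_ x f_ x1 y1 xx fS fcst mid fx.
have f1 n z : `|f_ n z| <= `|z| by exact: dual_sphere_le.
have cx := norm_vec_cvg E_MLUR x1 y1 xx mid.
have midC : midpoint_cvg y_ x_ x.
  rewrite /midpoint_cvg; under eq_fun do rewrite [y_ _ + _]addrC; exact: mid.
have cy := norm_vec_cvg E_MLUR y1 x1 xx midC.
have coord i (z_ : S^nat) : (fun n => norm_vec (z_ n)) @ \oo --> norm_vec x ->
    (fun n => `|ns_val (z_ n) i|) @ \oo --> `|ns_val x i|.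
  move=> cz; apply/cvgrPdist_lt => e e0.
  move/cvgrPdist_lt : cz => /(_ e e0); apply: filterS => n; apply: le_lt_trans.
  exact: (as_coord_le i (ns_valP (norm_vec x - norm_vec (z_ n)))).
have diff0 : (fun n => f_ n (x_ n - y_ n) : R) @ \oo --> (0 : R).
  apply: (cvg0_of_coords E_dense f1 cx cy) => i.
  pose g n : {linear X i -> R^o} := f_ n \o @single _ _ E X i.
  apply: (@acs_for_nearly_norming _ cst (X i) (fun n => ns_val (x_ n) i)
    (fun n => ns_val (y_ n) i) (ns_val x i) g (fun n => 1 - f_ n (x_ n))) => //.
  - by move=> n z; apply: le_trans (f1 n _) _; rewrite norm_single.
  - by move=> c n; rewrite /g (fcst c n).
  - exact: coord.
  - exact: coord.
  - apply: (squeeze_cvgr _ (cvg_cst 0) mid); apply: nearW => n.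
    by rewrite normr_ge0; exact: (abs_sum_coord (x - 2^-1 *: (x_ n + y_ n)) i).
  - move=> n z zx.
    rewrite -linearB /g /= lerBrDl -linearD -(x1 n).
    apply: le_trans (ler_norm _) _; apply: le_trans (f1 n _) _.
    exact: norm_replace.
  - by rewrite -(subrr (1 : R)); apply: cvgB => //; exact: cvg_cst.
rewrite -(subr0 (1 : R)).
have -> : (fun n => f_ n (y_ n)) = (fun n => f_ n (x_ n) - f_ n (x_ n - y_ n)).
  by apply/funext => n; rewrite linearB subKr.
exact: cvgB.
Qed.

End Main.

Theorem proposition4p7 (R : realType) (I : Type) (I_nonempty : inhabited I)
    (E : absNormedSpace R I)
    (E_dense : dense (lin_span (range (as_unit E))))
    (X : I -> completeNormedModType R) (E_MLUR : MLUR E) :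
  ((forall i, msluacs (X i)) -> msluacs (abs_sum E X)) /\
  ((forall i, mluacs (X i)) -> mluacs (abs_sum E X)).
Proof.
split=> HX.
  apply/acs_for_msluacs; apply: abs_sum_acs_for => // i.
  exact/acs_for_msluacs.
apply/acs_for_mluacs; apply: abs_sum_acs_for => // i.
exact/acs_for_mluacs.
Qed.
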